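(* Let $(X,X_+,\mathcal K,f)$ be an abstract state space and let $\mathcal S=(S_t)_{t\ge0}$, $\mathcal T=(T_t)_{t\ge0}$ be $C_0$-Markov semigroups on $X$ with generators $A$ and $C$, respectively, such that $A$ and $C$ have the same domain and $B:=C-A$ is bounded (i.e. extends to a bounded linear operator on $X$, again denoted $B$). Suppose there exist $\rho\in[0,1)$ and $t_0>0$ such that $\delta(T_{t_0})\le\rho$. Then for every $x,z\in\mathcal K$, $$\|T_tx-S_tz\|\le\begin{cases}\|x-z\|+t\|B\|, & 0\le t\le t_0,\\[1mm] \rho^{[t/t_0]}\|x-z\|+\Big(\dfrac{t_0(1-\rho^{[t/t_0]})}{1-\rho}+\rho^{[t/t_0]}\,(t-t_0[t/t_0])\Big)\|B\|, & t>t_0,\end{cases}$$ where $[a]$ denotes the integer part of $a$.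
   Context: Abstract state space $(X,X_+,\mathcal K,f)$: $X$ is a real vector space ordered by a generating cone $X_+$ (so $X=X_+-X_+$), $f$ is a linear functional on $X$ with $f(x)>0$ for all $x\in X_+\setminus\{0\}$, and $\mathcal K=\{x\in X_+: f(x)=1\}$. Let $U$ be the convex hull of $\mathcal K\cup(-\mathcal K)$ and $\|x\|=\inf\{\lambda\ge0: x\in\lambda U\}$. It is assumed that $\|\cdot\|$ is a norm, that $X$ is complete for it, and that $X_+$ is closed. Norms of operators are operator norms. A linear operator $T:X\to X$ is Markov if it is positive ($Tx\ge0$ whenever $x\ge 0$) and $T(\mathcal K)\subset\mathcal K$. A $C_0$-Markov semigroup is a strongly continuous one-parameter semigroup $(T_t)_{t\ge0}$ on $X$ ($T_0=I$, $T_{t+s}=T_tT_s$, $\|T_tx-x\|\to0$ as $t\downarrow0$ for every $x\in X$) such that every $T_t$ is Markov. Dobrushin's ergodicity coefficient of a Markov operator $T$: with $N=\{x\in X: f(x)=0\}$, $\delta(T)=\sup_{x\in N,\,x\ne0}\|Tx\|/\|x\|$. *)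

(* Defs.v *)
From HB Require Import structures.
From mathcomp Require Import all_boot all_order all_algebra.
From mathcomp Require Import all_classical all_reals all_analysis.

Set Implicit Arguments.
Unset Strict Implicit.
Unset Printing Implicit Defensive.

Import Order.TTheory GRing.Theory Num.Theory.
Import numFieldNormedType.Exports.

Local Open Scope classical_set_scope.
Local Open Scope ring_scope.

Definition convex_hull (R : numDomainType) (X : lmodType R) (A : set X) : set X :=
  smallest (@convex_set R X) A.

Definition base (R : realType) (X : lmodType R) (Xp : set X) (f : {scalar X}) :
    set X :=
  [set x | Xp x /\ f x = 1].

Definition base_unit (R : realType) (X : lmodType R) (Xp : set X)
    (f : {scalar X}) : set X :=
  convex_hull (base Xp f `|` [set - x | x in base Xp f]).

Definition base_norm (R : realType) (X : lmodType R) (Xp : set X)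
    (f : {scalar X}) (x : X) : R :=
  inf [set l : R | 0 <= l /\ exists2 u, base_unit Xp f u & x = l *: u].

(* That the Minkowski functional is a norm making X complete is expressed by
   taking X to be a Banach space whose norm is that functional.  The cone is
   pointed (Xp meets -Xp only in 0) because f is strictly positive on it. *)
Record abstract_state_space (R : realType) (X : completeNormedModType R)
    (Xp : set X) (f : {scalar X}) : Prop := AbstractStateSpace {
  ass_coneD : forall x y, Xp x -> Xp y -> Xp (x + y) ;
  ass_coneZ : forall (a : R) x, 0 <= a -> Xp x -> Xp (a *: x) ;
  ass_generating : forall x, exists y z, [/\ Xp y, Xp z & x = y - z] ;
  ass_gt0 : forall x, Xp x -> x != 0 -> 0 < f x ;
  ass_norm : forall x, `|x| = base_norm Xp f x ;
  ass_closed : closed Xp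
}.

Definition markov (R : realType) (X : lmodType R) (Xp : set X) (f : {scalar X})
    (T : {linear X -> X}) : Prop :=
  [set T x | x in Xp] `<=` Xp /\
  [set T x | x in base Xp f] `<=` base Xp f.

(* The values T t at t < 0 are irrelevant. *)
Record C0_markov_semigroup (R : realType) (X : normedModType R) (Xp : set X)
    (f : {scalar X}) (T : R -> {linear X -> X}) : Prop := C0MarkovSemigroup {
  c0_id : forall x, T 0 x = x ;
  c0_comp : forall s t x, 0 <= s -> 0 <= t -> T (t + s) x = T t (T s x) ;
  c0_cvg : forall x, T t x @[t --> 0^'+] --> x ;
  c0_markov : forall t, 0 <= t -> markov Xp f (T t)
}.

Definition gen_quotient (R : realType) (X : normedModType R)
    (T : R -> {linear X -> X}) (x : X) (h : R) : X :=
  h^-1 *: (T h x - x).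

Definition gen_dom (R : realType) (X : normedModType R)
    (T : R -> {linear X -> X}) : set X :=
  [set x | cvg (gen_quotient T x h @[h --> 0^'+])].

(* Meaningful only on gen_dom T. *)
Definition generator (R : realType) (X : normedModType R)
    (T : R -> {linear X -> X}) (x : X) : X :=
  lim (gen_quotient T x h @[h --> 0^'+]).

(* Real-valued suprema are 0 on unbounded sets, so opnorm is the operator norm
   for bounded operators only. *)
Definition opnorm (R : realType) (X : normedModType R) (B : {linear X -> X}) : R :=
  sup [set `|B x| | x in [set x | `|x| <= 1]].

(* For a Markov operator the ratios are at most 1, so the supremum is the true
   one; it is 0 when the kernel of f is trivial. *)
Definition dobrushin (R : realType) (X : normedModType R) (f : {scalar X})
    (T : {linear X -> X}) : R :=
  sup [set `|T x| / `|x| | x in [set x | f x = 0 /\ x != 0]].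

(* Main.v *)
(* A Markov operator contracts the base norm, so both semigroups are contraction
   semigroups.  For z in the domain, s |-> T_{h-s} S_s z joins T_h z to S_h z and
   its right difference quotients at s are bounded in the limit by |B S_s z|, so
   |T_h z - S_h z| <= h |B| |z|; this extends to all z because the domain is
   dense.  Writing t = n t0 + r, the distance is at most |x - z| + r |B| at time
   r, and each further step of length t0 multiplies it by at most rho (the
   difference of two states lies in ker f) and adds at most t0 |B|.

   Density needs no vector-valued integral: the mean of S over [0, t] is the
   limit M of the averages of S_{kt/n} x over k < n, and telescoping orbit sums
   gives (S_h - 1) M / h --> (S_t - 1) x / t directly. *)

Require Import Defs.
From HB Require Import structures.
From mathcomp Require Import all_boot all_order all_algebra.
From mathcomp Require Import all_classical all_reals all_analysis.
From mathcomp Require Import ring lra.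
Set Implicit Arguments.
Unset Strict Implicit.
Unset Printing Implicit Defensive.
Import Order.TTheory GRing.Theory Num.Theory.
Import numFieldNormedType.Exports.
Local Open Scope classical_set_scope.
Local Open Scope ring_scope.

(** * Contraction semigroups, orbit sums and their averages *)

Record contraction_semigroup (R : realType) (X : normedModType R)
    (S : R -> {linear X -> X}) : Prop := ContractionSemigroup {
  csg_id : forall x, S 0 x = x ;
  csg_comp : forall s t x, 0 <= s -> 0 <= t -> S (t + s) x = S t (S s x) ;
  csg_cvg : forall x, S h x @[h --> 0^'+] --> x ;
  csg_le : forall t x, 0 <= t -> `|S t x| <= `|x|
}.

Lemma at_right0P (R : realType) (P : set R) :
  (\forall h \near 0^'+, P h) <->
  exists2 d : R, 0 < d & forall h, 0 < h -> h < d -> P h.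
Proof.
split.
  rewrite near_withinE => /nbhs_ballP[d /= d0 dP]; exists d => // h h0 hd.
  by apply: dP => //; rewrite /ball/= sub0r normrN gtr0_norm.
move=> [d d0 dP]; near=> h; apply: dP; near: h.
- exact: nbhs_right_gt.
- exact: nbhs_right_lt.
Unshelve. all: by end_near. Qed.

Section Csg.
Context (R : realType) (X : normedModType R) (S : R -> {linear X -> X}).
Hypothesis hS : contraction_semigroup S.
Implicit Types (x : X) (s t h e : R).

Lemma csg_near0 x e : 0 < e ->
  exists2 d : R, 0 < d & forall h : R, 0 <= h -> h < d -> `|S h x - x| <= e.
Proof.
move=> e0;
have /cvgrPdist_le/(_ _ e0)/at_right0P[d d0 dP] := @csg_cvg _ _ _ hS x.
exists d => // h; rewrite le_eqVlt => /predU1P[<- _|h0 hd].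
  by rewrite (csg_id hS) subrr normr0 ltW.
by rewrite distrC dP.
Qed.

Lemma csg_dist x s h : 0 <= s -> 0 <= h ->
  `|S (s + h) x - S s x| <= `|S h x - x|.
Proof. by move=> s0 h0; rewrite (csg_comp hS)// -linearB csg_le. Qed.

(** The semigroup law makes orbit sums a cocycle. Splitting one sum in both orders gives the
    telescoping behind [csg_avg_diff]. *)
Lemma csg_osumD x tau m n : 0 <= tau ->
  \sum_(k < m + n) S (k%:R * tau) x =
  \sum_(k < m) S (k%:R * tau) x
  + S (m%:R * tau) (\sum_(k < n) S (k%:R * tau) x).
Proof.
move=> tau0; rewrite big_split_ord/=; congr (_ + _).
rewrite linear_sum; apply: eq_bigr => k _.
by rewrite natrD mulrDl (csg_comp hS) ?mulr_ge0.
Qed.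

Lemma csg_osum_near x tau n e :
  (forall k, (k < n)%N -> `|S (k%:R * tau) x - x| <= e) ->
  `|\sum_(k < n) S (k%:R * tau) x - n%:R *: x| <= n%:R * e.
Proof.
move=> H; have -> : n%:R *: x = \sum_(k < n) x.
  by rewrite sumr_const card_ord scaler_nat.
rewrite -sumrB; apply: le_trans (ler_norm_sum _ _ _) _.
have -> : n%:R * e = \sum_(k < n) e by rewrite sumr_const card_ord mulr_natl.
by apply: ler_sum => k _; exact: H.
Qed.

(** The fine sum splits into [n] blocks of [q] terms. Each is the image under a contraction of the
    first block, which is within [q * e] of [q *: x]. *)
Lemma csg_osum_refine x tau q n e : 0 <= tau ->
  (forall k, (k < q)%N -> `|S (k%:R * tau) x - x| <= e) ->
  `|\sum_(k < n * q) S (k%:R * tau) x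
    - q%:R *: \sum_(k < n) S (k%:R * (q%:R * tau)) x| <= (n * q)%:R * e.
Proof.
move=> tau0 H; elim: n => [|n IH].
  by rewrite mul0n !big_ord0 scaler0 subrr normr0 mul0r.
rewrite mulSn addnC csg_osumD// big_ord_recr/= scalerDr opprD addrACA.
rewrite natrD mulrDl (le_trans (ler_normD _ _))// lerD// natrM -mulrA.
rewrite -linearZ -linearB (le_trans (csg_le hS _ _)) ?mulr_ge0//.
exact: csg_osum_near.
Qed.

(** Left Riemann sum, on [n] equal steps, for the mean of the orbit of [x] over [0, t]. *)
Definition csg_avg x t n : X :=
  n%:R^-1 *: \sum_(k < n) S (k%:R * (t / n%:R)) x.

Lemma csg_avg_near x t n e : (0 < n)%N -> 0 <= t ->
  (forall h, 0 <= h -> h <= t -> `|S h x - x| <= e) ->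
  `|csg_avg x t n - x| <= e.
Proof.
move=> n0 t0 H; have n0' : 0 < n%:R :> R by rewrite ltr0n.
rewrite -[X in _ - X](scalerK (lt0r_neq0 n0')) -scalerBr normrZ.
rewrite gtr0_norm ?invr_gt0// ler_pdivrMl//.
apply: csg_osum_near => k kn; apply: H; first by rewrite mulr_ge0// divr_ge0.
by rewrite mulrCA ler_piMr// ler_pdivrMr// mul1r ler_nat ltnW.
Qed.

(** The bound is uniform in [q], so two averages can be compared through a common refinement. *)
Lemma csg_avg_refine x t q n e : (0 < n)%N -> (0 < q)%N -> 0 <= t ->
  (forall h, 0 <= h -> h <= t / n%:R -> `|S h x - x| <= e) ->
  `|csg_avg x t (n * q) - csg_avg x t n| <= e.
Proof.
move=> n0 q0 t0 H; have n0' : 0 < n%:R :> R by rewrite ltr0n.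
have q0' : 0 < q%:R :> R by rewrite ltr0n.
have nq : 0 < (n * q)%:R :> R by rewrite natrM mulr_gt0.
have -> : csg_avg x t n =
    (n * q)%:R^-1 *:
      (q%:R *: \sum_(k < n) S (k%:R * (q%:R * (t / (n * q)%:R))) x).
  rewrite scalerA /csg_avg natrM; congr (_ *: _).
    by rewrite invfM -mulrA mulVf ?mulr1// gt_eqF.
  apply: eq_bigr => k _; congr (S (_ * _) x).
  by field; rewrite !gt_eqF.
rewrite -scalerBr normrZ gtr0_norm ?invr_gt0// ler_pdivrMl//.
apply: csg_osum_refine; first by rewrite divr_ge0.
move=> k kq; apply: H; first by rewrite mulr_ge0// divr_ge0.
have -> : k%:R * (t / (n * q)%:R) = t / n%:R * (k%:R / q%:R).
  by rewrite natrM; field; rewrite !gt_eqF.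
by rewrite ler_piMr ?divr_ge0// ler_pdivrMr// mul1r ler_nat ltnW.
Qed.

(** With tau = t / n, telescoping gives (S_{j tau} - 1) (sum n) = (S_t - 1) (sum j). Since [sum j]
    is within [j * e] of [j *: x], applying S_t - 1 at most doubles the error. *)
Lemma csg_avg_diff x t n j e : (0 < n)%N -> 0 <= t ->
  (forall s, 0 <= s -> s <= j%:R * (t / n%:R) -> `|S s x - x| <= e) ->
  `|S (j%:R * (t / n%:R)) (csg_avg x t n) - csg_avg x t n
    - (j%:R / n%:R) *: (S t x - x)| <= 2 * (j%:R / n%:R) * e.
Proof.
move=> n0 t0 H; have n0' : 0 < n%:R :> R by rewrite ltr0n.
set tau := t / n%:R in H *; have tau0 : 0 <= tau by rewrite divr_ge0.
have nt : n%:R * tau = t by rewrite /tau mulrC divfK// gt_eqF.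
pose sum i := \sum_(k < i) S (k%:R * tau) x.
have Sh : S (j%:R * tau) (sum n) = sum n + S t (sum j) - sum j.
  by rewrite -{1}nt -csg_osumD// addnC csg_osumD// addrAC subrr add0r.
have -> : csg_avg x t n = n%:R^-1 *: sum n by [].
rewrite linearZ/= Sh -scalerBr.
have -> : sum n + S t (sum j) - sum j - sum n = S t (sum j) - sum j.
  by rewrite addrAC [sum n + _]addrC addrK.
have -> : 2 * (j%:R / n%:R) * e = n%:R^-1 * (2 * (j%:R * e)) by ring.
rewrite [j%:R / _]mulrC -scalerA -scalerBr normrZ gtr0_norm ?invr_gt0//.
rewrite ler_pM2l ?invr_gt0//.
have -> : S t (sum j) - sum j - j%:R *: (S t x - x) =
          S t (sum j - j%:R *: x) - (sum j - j%:R *: x).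
  rewrite scalerBr [S t (_ - _)]linearB [S t (_ *: x)]linearZ/= !opprB.
  by rewrite [_ *: x - _ *: _]addrC addrACA [- sum j + _]addrC.
have H' : `|sum j - j%:R *: x| <= j%:R * e.
  apply: csg_osum_near => k kj; apply: H; first by rewrite mulr_ge0.
  by rewrite ler_wpM2r// ler_nat ltnW.
rewrite (le_trans (ler_normB _ _))// mulrDl mul1r.
by rewrite lerD// (le_trans (csg_le hS _ _)).
Qed.

(** This is the limit of [csg_avg_diff] as n grows, with [j * (t / n)] the last mesh point not
    exceeding [h]. *)
Lemma csg_avg_lim_diff x t h e (M : X) : 0 < t -> 0 <= h ->
  csg_avg x t n @[n --> \oo] --> M ->
  (forall s, 0 <= s -> s <= h -> `|S s x - x| <= e) ->
  `|S h M - M - (h / t) *: (S t x - x)| <= 2 * (h / t) * e.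
Proof.
move=> t0 h0 /cvgrPdist_le PM He; apply/ler_addgt0Pr => eta eta0.
have e0 : 0 <= e by rewrite (le_trans _ (He 0 _ _)).
have eta4 : 0 < eta / 4 by rewrite divr_gt0.
have [d d0 Hd] := csg_near0 M eta4.
set D := S t x - x.
near \oo => n.
have n0 : (0 < n)%N by near: n; exact: nbhs_infty_gt.
have n0' : 0 < n%:R :> R by rewrite ltr0n.
have tn : t / n%:R < d.
  rewrite ltr_pdivrMr// mulrC -ltr_pdivrMr//; near: n; exact: nbhs_infty_gtr.
have Dn : n%:R^-1 * `|D| <= eta / 4.
  rewrite mulrC ler_pdivrMr// mulrC -ler_pdivrMr//; near: n.
  exact: nbhs_infty_ger.
have Pn : `|M - csg_avg x t n| <= eta / 4 by near: n; exact: PM.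
set P := csg_avg x t n in Pn.
set j := Num.truncn (h / (t / n%:R)); set tau := t / n%:R in tn j.
have tau0 : 0 < tau by rewrite divr_gt0.
have /andP[jle jlt] : j%:R <= h / tau < j.+1%:R.
  by apply: truncn_itv; rewrite divr_ge0// ltW.
have jh : j%:R * tau <= h by rewrite -ler_pdivlMr.
have j0 : 0 <= j%:R * tau by rewrite mulr_ge0// ltW.
have hj : h - j%:R * tau < tau.
  by move: jlt; rewrite ltr_pdivrMr// -natr1 mulrDl mul1r ltrBlDl.
have jn : j%:R / n%:R = j%:R * tau / t.
  by rewrite /tau; field; rewrite !gt_eqF.
have := @csg_avg_diff x t n j e n0 (ltW t0).
rewrite -/tau -/P -/D jn =>
  /(_ (fun s (s0 : 0 <= s) sj => He s s0 (le_trans sj jh))) H.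
have H1 : `|S h M - S (j%:R * tau) M| <= eta / 4.
  have {1}-> : h = j%:R * tau + (h - j%:R * tau) by rewrite addrC subrK.
  apply: le_trans (csg_dist _ _ _) _; rewrite ?subr_ge0//.
  by apply: Hd; rewrite ?subr_ge0// (lt_trans hj).
have H2 : `|S (j%:R * tau) M - S (j%:R * tau) P| <= eta / 4.
  by rewrite -linearB (le_trans (csg_le hS _ _)).
have H3 : `|(j%:R * tau / t - h / t) *: D| <= eta / 4.
  apply: le_trans Dn; rewrite normrZ ler_wpM2r// distrC -mulrBl ger0_norm.
    rewrite ler_pdivrMr// [_ * t]mulrC -/tau; exact: ltW.
  by rewrite divr_ge0// ?subr_ge0// ltW.
(* Four errors of at most [eta / 4] surround the bound for [P]: rounding [h] down to [j * tau] in
   the operator and in the coefficient, and replacing [M] by [P] twice. *)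
have -> : S h M - M - (h / t) *: D =
   (S h M - S (j%:R * tau) M) + (S (j%:R * tau) M - S (j%:R * tau) P)
   + (S (j%:R * tau) P - P - (j%:R * tau / t) *: D) - (M - P)
   + (j%:R * tau / t - h / t) *: D.
  set a := S h M; set b := S _ M; set c := S _ P; rewrite scalerBl.
  set u := (j%:R * tau / t) *: D; set v := (h / t) *: D.
  rewrite [a - b + _]addrA subrK [_ + (c - P - u)]addrA
    [_ + (c - P)]addrA subrK.
  by rewrite opprB [a - P - u]addrAC [_ + (P - M)]addrA subrK addrA
    [a - u - M]addrAC subrK.
have Hm : 2 * (j%:R * tau / t) * e <= 2 * (h / t) * e.
  by rewrite ler_wpM2r// ler_wpM2l// ler_wpM2r// invr_ge0 ltW.
have H12 := le_trans (ler_normD _ _) (lerD H1 H2).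
have H012 := le_trans (ler_normD _ _) (lerD H12 H).
have H0123 := le_trans (ler_normB _ _) (lerD H012 Pn).
apply: le_trans (ler_normD _ _) _; apply: le_trans (lerD H0123 H3) _; lra.
Unshelve. all: by end_near. Qed.

End Csg.

(** * Density of the domain of a generator, and a mean value inequality *)

(** The averages on [n] and on [m] steps are both close to the one on [n * m] steps, so the sequence
    is Cauchy. *)
Lemma csg_avg_cvg (R : realType) (X : completeNormedModType R)
    (S : R -> {linear X -> X}) (x : X) (t : R) :
  contraction_semigroup S -> 0 < t -> cvg (csg_avg S x t n @[n --> \oo]).
Proof.
move=> hS t0; apply/cauchy_cvgP/cauchy_ballP => e e0.
have e4 : 0 < e / 4 by rewrite divr_gt0.
have [d d0 Hd] := csg_near0 hS x e4.
pose big n := (0 < n)%N /\ t / n%:R < d.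
have big_near : \forall n \near \oo, big n.
  near=> n.
  have n0 : (0 < n)%N by near: n; exact: nbhs_infty_gt.
  split=> //; rewrite ltr_pdivrMr ?ltr0n// mulrC -ltr_pdivrMr//; near: n.
  exact: nbhs_infty_gtr.
have close n m : big n -> big m ->
    `|csg_avg S x t (n * m) - csg_avg S x t n| <= e / 4.
  move=> [n0 nd] [m0 _]; apply: csg_avg_refine => // [|h h0 hn].
    exact: ltW.
  by apply: Hd => //; exact: le_lt_trans nd.
exists (csg_avg S x t @` big, csg_avg S x t @` big) => /=.
  by split; apply: filterS big_near => n bn; exists n.
move=> [_ _] /= [[n bn <-] [m bm <-]]; rewrite -ball_normE/=.
have := close _ _ bm bn; rewrite mulnC; have := close _ _ bn bm.
set P := csg_avg S x t (n * m) => H1 H2.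
rewrite -[X in X - _](subrK P) -addrA.
apply: le_lt_trans (ler_normD _ _) _; rewrite distrC in H1 *.
lra.
Unshelve. all: by end_near. Qed.

Lemma gen_dom_dense (R : realType) (X : completeNormedModType R)
    (S : R -> {linear X -> X}) (x : X) (e : R) :
  contraction_semigroup S -> 0 < e -> exists2 y, gen_dom S y & `|y - x| <= e.
Proof.
move=> hS e0; have [d d0 Hd] := csg_near0 hS x e0.
have t0 : 0 < d / 2 by rewrite divr_gt0.
set t := d / 2 in t0; have td : t < d by rewrite /t; lra.
have PM := csg_avg_cvg (x := x) hS t0.
exists (lim (csg_avg S x t n @[n --> \oo])); last first.
  rewrite distrC; apply: (cvgr_to_le (cvg_norm (cvgB (cvg_cst x) PM))).
  near=> n; rewrite distrC; apply: csg_avg_near => //.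
  - by near: n; exact: nbhs_infty_gt.
  - exact: ltW.
  - by move=> h h0 ht; apply: Hd => //; exact: le_lt_trans td.
set M := lim _ in PM *; apply/cvg_ex; exists (t^-1 *: (S t x - x)) => /=.
apply/cvgrPdist_le => eta eta0.
(* This tolerance turns the bound [2 * (h / t) * e] of [csg_avg_lim_diff] into [h * eta], which
   absorbs the division by [h]. *)
have e'0 : 0 < eta * t / 2 by rewrite divr_gt0 ?mulr_gt0.
have [d' d'0 Hd'] := csg_near0 hS x e'0.
apply/at_right0P; exists d' => // h h0 hd'.
have := csg_avg_lim_diff (e := eta * t / 2) hS t0 (ltW h0) PM.
move=> /(_ (fun s (s0 : 0 <= s) sh => Hd' s s0 (le_lt_trans sh hd'))) H.
rewrite distrC /gen_quotient; set D := S t x - x in H *.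
have -> : h^-1 *: (S h M - M) - t^-1 *: D = h^-1 *: (S h M - M - (h / t) *: D).
  by rewrite [RHS]scalerBr scalerA mulKf// gt_eqF.
rewrite normrZ gtr0_norm ?invr_gt0// ler_pdivrMl//.
have -> : h * eta = 2 * (h / t) * (eta * t / 2) by field; rewrite gt_eqF.
by [].
Unshelve. all: by end_near. Qed.

(* The set of s in [0, h] such that |phi s - phi 0| <= L s contains its supremum
   by left continuity; were that below h, the right-hand bound would exceed it. *)
Lemma dini_le (R : realType) (X : normedModType R) (phi : R -> X) (h L : R) :
  0 <= h -> 0 <= L ->
  (forall s : R, 0 <= s -> s < h -> exists2 d : R, 0 < d &
     forall r : R, 0 < r -> r < d -> s + r <= h ->
     `|phi (s + r) - phi s| <= L * r) ->
  (forall s e : R, 0 < s -> s <= h -> 0 < e -> exists2 d : R, 0 < d &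
     forall r : R, 0 < r -> r < d -> r <= s -> `|phi s - phi (s - r)| <= e) ->
  `|phi h - phi 0| <= L * h.
Proof.
move=> h0 L0 right left.
pose E := [set s : R | [/\ 0 <= s, s <= h & `|phi s - phi 0| <= L * s]].
have E0 : E 0 by split => //; rewrite subrr normr0 mulr0.
have hE : has_sup E by split; [exists 0 | exists h => s []].
have ub (s : R) : E s -> s <= sup E by apply: ub_le_sup; case: hE.
have c0 : 0 <= sup E by exact: ub.
have ch : sup E <= h by apply: ge_sup; [exists 0 | move=> s []].
have Ec : E (sup E).
  split => //; apply/ler_addgt0Pr => e e0.
  move: c0; rewrite le_eqVlt => /predU1P[<-|c0].
    by rewrite subrr normr0 mulr0 add0r ltW.
  have [d d0 Hd] := left _ _ c0 ch e0.
  have [s Es sd] := sup_adherent d0 hE.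
  case: (Es) => s0 sh sL.
  have := ub _ Es; rewrite le_eqVlt => /predU1P[<-|sc].
    lra.
  have := Hd (sup E - s); rewrite subr_gt0 subKr => /(_ sc) H.
  have {}H : `|phi (sup E) - phi s| <= e by apply: H; lra.
  rewrite -[X in X - _](subrK (phi s)) -addrA (le_trans (ler_normD _ _))//.
  have := ler_wpM2l L0 (ltW sc); lra.
move: ch; rewrite le_eqVlt => /predU1P[<-|ch]; first by case: Ec.
have [d d0 Hd] := right _ c0 ch.
pose r := Num.min (d / 2) (h - sup E).
have r0 : 0 < r by rewrite lt_min subr_gt0 ch divr_gt0.
have rd : r < d by rewrite gt_min; apply/orP; left; lra.
have rh : sup E + r <= h by rewrite -lerBrDl ge_min lexx orbT.
have : E (sup E + r).
  case: Ec => _ _ Ec; split => //; first by rewrite addr_ge0// ltW.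
  rewrite -[X in X - _](subrK (phi (sup E))) -addrA.
  rewrite (le_trans (ler_normD _ _))//.
  by rewrite mulrDr [leRHS]addrC lerD// Hd.
by move=> /ub; rewrite gerDl leNgt r0.
Qed.

(** * The operator norm of a bounded operator *)

Lemma opnorm_has_ubound (R : realType) (X : normedModType R)
    (B : {linear X -> X}) :
  bounded_near B (nbhs (0 : X)) ->
  has_ubound [set `|B x| | x in [set x | `|x| <= 1]].
Proof.
move=> /linear_boundedP [M [_ HM]].
(* Only constants strictly above [M] are known to be bounds, hence [M + 1]; the maximum with 0
   allows multiplication by a norm at most 1. *)
exists (Num.max (M + 1) 0) => _ [y /= y1 <-].
have M1 : M < Num.max (M + 1) 0 by rewrite lt_max ltrDl ltr01.
by rewrite (le_trans (HM _ M1 y))// ler_piMr// le_max lexx orbT.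
Qed.

Lemma opnorm_ge0 (R : realType) (X : normedModType R) (B : {linear X -> X}) :
  bounded_near B (nbhs (0 : X)) -> 0 <= opnorm B.
Proof.
move=> /opnorm_has_ubound/ub_le_sup; apply.
by exists 0; rewrite /= ?linear0 normr0 ?ler01.
Qed.

Lemma le_opnorm (R : realType) (X : normedModType R) (B : {linear X -> X})
    (x : X) :
  bounded_near B (nbhs (0 : X)) -> `|B x| <= opnorm B * `|x|.
Proof.
move=> hB; have [->|x0] := eqVneq x 0; first by rewrite linear0 normr0 mulr0.
have nx : 0 < `|x| by rewrite normr_gt0.
rewrite -ler_pdivrMr//; apply: ub_le_sup; first exact: opnorm_has_ubound.
exists (`|x|^-1 *: x); first by rewrite /= normfZV.
by rewrite linearZ normrZ gtr0_norm ?invr_gt0// mulrC.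
Qed.

(** * Comparison of two contraction semigroups *)

Section Perturbation.
Context (R : realType) (X : completeNormedModType R).
Context (S T : R -> {linear X -> X}) (B : {linear X -> X}) (b : R).
Hypotheses (hS : contraction_semigroup S) (hT : contraction_semigroup T).
Hypothesis hdom : gen_dom S `<=` gen_dom T.
Hypothesis hB : forall x, gen_dom S x -> B x = generator T x - generator S x.
Hypothesis b0 : 0 <= b.
Hypothesis hb : forall x, `|B x| <= b * `|x|.

(** [S s] commutes with the difference quotients and, being a contraction, preserves their
    convergence. *)
Lemma gen_dom_csg (z : X) (s : R) : 0 <= s -> gen_dom S z -> gen_dom S (S s z).
Proof.
move=> s0 Dz; apply/cvg_ex; exists (S s (generator S z)).
apply/cvgrPdist_le => e e0.
have /cvgrPdist_le/(_ _ e0)/at_right0P[d d0 Hd] := Dz.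
apply/at_right0P; exists d => // h h0 hd.
have -> : gen_quotient S (S s z) h = S s (gen_quotient S z h).
  rewrite /gen_quotient linearZ/= [S s (_ - _)]linearB/=.
  have SC : S h (S s z) = S s (S h z).
    by rewrite -!(csg_comp hS) ?(ltW h0)// [h + s]addrC.
  by rewrite SC.
by rewrite -linearB (le_trans (csg_le hS _ _))// Hd.
Qed.

Lemma csg_perturb_dom (z : X) (h : R) : gen_dom S z -> 0 <= h ->
  `|T h z - S h z| <= b * `|z| * h.
Proof.
move=> Dz h0; apply/ler_addgt0Pr => eta eta0.
(* The slope is enlarged by [e] because the quotients only converge to [B y]; over length [h] this
   costs at most [eta], and the [+ 1] covers [h = 0]. *)
pose e := eta / (h + 1); have e0 : 0 < e by rewrite divr_gt0// ltr_wpDl.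
have le : (b * `|z| + e) * h <= b * `|z| * h + eta.
  rewrite mulrDl lerD2l /e mulrAC ler_pdivrMr ?ltr_wpDl// ler_pM2l//; lra.
apply: le_trans le.
pose phi s := T (h - s) (S s z).
have -> : `|T h z - S h z| = `|phi h - phi 0|.
  by rewrite /phi subrr subr0 (csg_id hT) (csg_id hS) distrC.
apply: dini_le => // [|s s0 sh|s e' s0 sh e'0].
- by apply: addr_ge0; [exact: mulr_ge0 | exact: ltW].
- set y := S s z; have Dy : gen_dom S y by exact: gen_dom_csg.
  have /cvgrPdist_le/(_ _ e0)/at_right0P[d d0 Hd] :
      gen_quotient T y r - gen_quotient S y r @[r --> 0^'+] --> B y.
    by rewrite hB//; apply: cvgB => //; exact: hdom.
  exists d => // r r0 rd srh.
  have hsr : 0 <= h - (s + r) by rewrite subr_ge0.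
  (* Both terms contain the contraction [T (h - (s + r))]; what remains is [r] times a difference of
     the two quotients at [y]. *)
  have -> : phi (s + r) - phi s = T (h - (s + r)) (S r y - T r y).
    have -> : phi s = T (h - (s + r)) (T r y).
      by rewrite -(csg_comp hT) ?(ltW r0)//; congr (T _ y); ring.
    have Sy : S (s + r) z = S r y by rewrite addrC (csg_comp hS) ?(ltW r0).
    by rewrite /phi Sy linearB.
  rewrite (le_trans (csg_le hT _ _))// mulrC -ler_pdivrMl//.
  have -> : r^-1 * `|S r y - T r y| =
      `|gen_quotient T y r - gen_quotient S y r|.
    rewrite /gen_quotient -scalerBr normrZ gtr0_norm ?invr_gt0//.
    by rewrite opprB addrA subrK distrC.
  have By : `|B y| <= b * `|z|.
    by rewrite (le_trans (hb _))// ler_wpM2l// csg_le.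
  have := lerD By (Hd _ r0 rd); apply: le_trans.
  by rewrite -[X in `|X| <= _](subKr (B y)) ler_normB.
- have e2 : 0 < e' / 2 by rewrite divr_gt0.
  have [d1 d10 H1] := csg_near0 hT (S s z) e2.
  have [d2 d20 H2] := csg_near0 hS z e2.
  exists (Num.min d1 d2) => [|r r0]; first by rewrite lt_min d10.
  rewrite lt_min => /andP[rd1 rd2] rs.
  have sr : 0 <= s - r by rewrite subr_ge0.
  (* Inserting [T r (S s z)] leaves only the moduli of continuity at the fixed vectors [S s z] and
     [z], never at the moving vector [S (s - r) z]. *)
  have -> : phi s - phi (s - r) = T (h - s) (S s z - T r (S (s - r) z)).
    rewrite linearB -(csg_comp hT _ (ltW r0)) ?subr_ge0//.
    by congr (_ - T _ _); ring.
  rewrite (le_trans (csg_le hT _ _)) ?subr_ge0//.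
  rewrite -[X in X - _](subrK (T r (S s z))) -addrA.
  rewrite (le_trans (ler_normD _ _))//.
  have -> : e' = e' / 2 + e' / 2 by field.
  rewrite lerD//; first by rewrite distrC H1// ltW.
  rewrite -linearB (le_trans (csg_le hT _ _)) ?(ltW r0)//.
  rewrite -{1}[s](subrK r) (le_trans (csg_dist hS _ _ _)) ?(ltW r0)//.
  by rewrite H2// ltW.
Qed.

Lemma csg_perturb (z : X) (h : R) : 0 <= h ->
  `|T h z - S h z| <= b * `|z| * h.
Proof.
move=> h0; apply/ler_addgt0Pr => eta eta0.
(* Replacing [z] by [y] costs [|y - z|] once for each semigroup, and [b * h] times it through
   [|y| <= |z| + |y - z|]. *)
have k0 : 0 < 2 + b * h by rewrite ltr_wpDr// mulr_ge0.
have e0 : 0 < eta / (2 + b * h) by rewrite divr_gt0.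
have [y Dy yz] := gen_dom_dense z hS e0.
have Hy := csg_perturb_dom Dy h0.
have HT : `|T h (y - z)| <= `|y - z| := csg_le hT (y - z) h0.
have HS : `|S h (y - z)| <= `|y - z| := csg_le hS (y - z) h0.
have -> : T h z - S h z = (T h y - S h y) - T h (y - z) + S h (y - z).
  rewrite [T h (y - z)]linearB [S h (y - z)]linearB opprB.
  by rewrite [_ + (T h z - _)]addrC !addrA !subrK.
have H1 := le_trans (ler_normB _ _) (lerD Hy HT).
apply: le_trans (ler_normD _ _) _; apply: le_trans (lerD H1 HS) _.
have yle : `|y| <= `|z| + `|y - z|.
  by rewrite -[X in `|X| <= _](subrK z) addrC ler_normD.
have := ler_wpM2r h0 (ler_wpM2l b0 yle).
have : (2 + b * h) * `|y - z| <= eta by rewrite -ler_pdivlMl// mulrC.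
lra.
Qed.

End Perturbation.

(** * Markov operators and the base norm *)

Section Markov.
Context (R : realType) (X : completeNormedModType R).
Context (Xp : set X) (f : {scalar X}).
Hypothesis hX : abstract_state_space Xp f.

(* The qualified name avoids markov, Markov's inequality in MathComp-Analysis. *)
Lemma markov_le (T : {linear X -> X}) (x : X) :
  Defs.markov Xp f T -> `|T x| <= `|x|.
Proof.
move=> [_ TK].
(* The preimage of a convex set under a linear map is convex, and this one contains the base and its
   negative, hence their hull. *)
have TU : base_unit Xp f `<=` T @^-1` base_unit Xp f.
  apply: smallest_sub => [u v p /set_mem uU /set_mem vU|u [Ku|[v Kv <-]]].
  - apply/mem_set => /= C CC; rewrite linearD !linearZ.
    by apply/set_mem/(CC.1 (T u) (T v) p); apply/mem_set;
      [exact: uU | exact: vU].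
  - by apply: sub_gen_smallest; left; apply: TK; exists u.
  - apply: sub_gen_smallest; right; exists (T v); last by rewrite linearN.
    by apply: TK; exists v.
rewrite !(ass_norm hX) /base_norm; set A := [set l | _]; set B := [set l | _].
have AB : B `<=` A.
  move=> l [l0 [u uU xE]]; split => //; exists (T u); first exact: TU.
  by rewrite xE linearZ.
have lbA : has_lbound A by exists 0 => l [].
(* If no [l] is admissible, the infimum is 0 by convention; then [x] has norm 0, so [x = 0] and the
   two sets agree. *)
have [B0|/set0P B0] := eqVneq B set0.
  have x0 : x = 0.
    by apply/normr0_eq0; rewrite (ass_norm hX) /base_norm -/B B0 inf0.
  suff -> : A = B by [].
  by rewrite /A /B x0 linear0.
by apply: lb_le_inf => // l Bl; apply: ge_inf => //; exact: AB.
Qed.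

Lemma norm_base_le1 (x : X) : base Xp f x -> `|x| <= 1.
Proof.
move=> Kx; rewrite (ass_norm hX); apply: ge_inf; first by exists 0 => l [].
split => //; exists x; last by rewrite scale1r.
by apply: sub_gen_smallest; left.
Qed.

Lemma markov_csg (T : R -> {linear X -> X}) :
  C0_markov_semigroup Xp f T -> contraction_semigroup T.
Proof.
move=> hT; split; [exact: c0_id hT|exact: c0_comp hT|exact: c0_cvg hT|].
by move=> t x t0; apply/markov_le/(c0_markov hT).
Qed.

(** Contractivity bounds the ratios by 1, so the real supremum dominates each of them. *)
Lemma le_dobrushin (T : {linear X -> X}) (x : X) :
  Defs.markov Xp f T -> f x = 0 ->
  `|T x| <= dobrushin f T * `|x|.
Proof.
move=> mT fx; have [->|x0] := eqVneq x 0; first by rewrite linear0 normr0 mulr0.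
rewrite -ler_pdivrMr ?normr_gt0//; apply: ub_le_sup; last by exists x.
exists 1 => _ [y [_ y0] <-].
by rewrite ler_pdivrMr ?normr_gt0// mul1r markov_le.
Qed.

Lemma markov_base (T : R -> {linear X -> X}) (x : X) (t : R) :
  C0_markov_semigroup Xp f T -> 0 <= t -> base Xp f x -> base Xp f (T t x).
Proof. by move=> hT t0 Kx; apply: (c0_markov hT t0).2; exists x. Qed.

End Markov.

Theorem theorem3p5 (R : realType) (X : completeNormedModType R)
  (Xp : set X) (f : {scalar X})
  (S T : R -> {linear X -> X}) (B : {linear X -> X}) (rho t0 : R)
  (hX : abstract_state_space Xp f)
  (hS : C0_markov_semigroup Xp f S)
  (hT : C0_markov_semigroup Xp f T)
  (hdom : gen_dom S = gen_dom T)
  (hBbounded : bounded_near B (nbhs (0 : X)))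
  (hB : forall x, gen_dom S x -> B x = generator T x - generator S x)
  (hrho0 : 0 <= rho) (hrho1 : rho < 1) (ht0 : 0 < t0)
  (hdelta : dobrushin f (T t0) <= rho) :
  forall x z : X, base Xp f x -> base Xp f z ->
  forall t : R, 0 <= t ->
    let n := Num.truncn (t / t0) in
    `|T t x - S t z| <=
      if t <= t0 then `|x - z| + t * opnorm B
      else rho ^+ n * `|x - z|
           + (t0 * (1 - rho ^+ n) / (1 - rho) + rho ^+ n * (t - t0 * n%:R))
             * opnorm B.
Proof.
have cS := markov_csg hX hS; have cT := markov_csg hX hT.
have step z h : 0 <= h -> base Xp f z -> `|T h z - S h z| <= h * opnorm B.
  move=> h0 Kz.
  have domST : gen_dom S `<=` gen_dom T by rewrite hdom.
  have := csg_perturb cS cT domST hB (opnorm_ge0 hBbounded)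
    (fun x => le_opnorm x hBbounded) z h0.
  move/le_trans; apply; rewrite mulrC ler_wpM2l// ler_piMr ?opnorm_ge0//.
  exact: norm_base_le1 Kz.
move=> x z Kx Kz.
have short r : 0 <= r -> `|T r x - S r z| <= `|x - z| + r * opnorm B.
  move=> r0; rewrite -[X in X - _](subrK (T r z)) -addrA.
  apply: le_trans (ler_normD _ _) _; apply: lerD; last exact: step.
  by rewrite -linearB csg_le.
move=> t t_ge0; cbv zeta; set n := Num.truncn _.
case: ifP => _; first exact: short.
have tt0 : 0 <= t / t0 by rewrite divr_ge0// ltW.
have /andP[nle _] := truncn_itv tt0; rewrite -/n in nle.
set r := t - t0 * n%:R.
have r0 : 0 <= r by rewrite subr_ge0 mulrC -ler_pdivlMr.
have -> : t = t0 * n%:R + r by rewrite addrC subrK.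
(* The remainder [r] is frozen, so the induction counts full steps of length [t0]; zero steps is the
   case [short]. *)
clearbody r; elim: {nle} n => [|k IH].
  rewrite mulr0 !add0r expr0 subrr mulr0 !mul0r add0r !mul1r; exact: short.
have u0 : 0 <= t0 * k%:R + r by rewrite addr_ge0 ?mulr_ge0// ltW.
have -> : t0 * k.+1%:R + r = t0 + (t0 * k%:R + r) by rewrite -natr1; ring.
rewrite (csg_comp cT) ?(ltW ht0)// (csg_comp cS) ?(ltW ht0)//.
set u := t0 * k%:R + r in u0 IH *.
have Kv := markov_base hT u0 Kx; have Kw := markov_base hS u0 Kz.
have rho_contr : `|T t0 (T u x) - T t0 (S u z)| <= rho * `|T u x - S u z|.
  have fN : f (T u x - S u z) = 0 by rewrite linearB Kv.2 Kw.2 subrr.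
  rewrite -linearB.
  apply: le_trans (le_dobrushin hX (c0_markov hT (ltW ht0)) fN) _.
  exact: ler_wpM2r.
have one := step _ _ (ltW ht0) Kw.
(* First [T t0] acts on both states, contracting by [rho]; then [T t0] is exchanged for [S t0] at
   the single state [S u z]. *)
rewrite -[X in X - _](subrK (T t0 (S u z))) -addrA.
apply: le_trans (ler_normD _ _) _; apply: le_trans (lerD rho_contr one) _.
apply: le_trans (lerD (ler_wpM2l hrho0 IH) (lexx _)) _.
(* The bounds agree exactly: 1 + rho (1 - rho^k) / (1 - rho) = (1 - rho^(k+1)) / (1 - rho). *)
rewrite le_eqVlt; apply/orP; left; apply/eqP; rewrite exprS.
by field; rewrite subr_eq0 gt_eqF.
Qed.
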